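(* Let $\Omega\subset\mathbb{R}$ be a bounded open interval, $b\in\mathbb{R}\setminus\{0\}$ constant, $f\in L_2(\Omega)$, $\mathcal{T}_h$ a mesh of $\Omega$, and $k'\ge 0$ an integer. Let $u_h\in L_2(\Omega)$ satisfy $$(f,\psi_a)_{\omega_a}+(u_h,b\nabla\psi_a)_{\omega_a}=0\qquad\forall\,a\in\mathcal{V}_h^{\mathrm{int}}\cup\mathcal{V}_h^{\partial_-\Omega},$$ and let $s_h=\sum_{a\in\mathcal{V}_h}\psi_a s_h^a$, where for each $a\in\mathcal{V}_h$, $s_h^a\in\mathcal{P}^{k'}(\mathcal{T}_a)\cap H^1(\omega_a)$ is the solution of $$(b\nabla(\psi_a s_h^a),v_h)_{\omega_a}=(f\psi_a+(b\nabla\psi_a)u_h,\,v_h)_{\omega_a}\qquad\forall\,v_h\in\mathcal{P}^{k'}(\mathcal{T}_a).$$ Then $$s_h\in\mathcal{P}^{k'+1}(\mathcal{T}_h)\cap H^1_-(\Omega),$$ and moreover the following orthogonality is satisfied: $$(f-b\nabla s_h,\,v_h)_K=0\qquad\forall\,v_h\in\mathcal{P}^{k'}(K),\quad\forall\,K\in\mathcal{T}_h.$$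
   Context: Notation: $(v,w)_D=\int_D vw$; $\nabla v=v'$. With $n=\pm1$ the outward unit normal at the endpoints of $\Omega$, $\partial_\pm\Omega=\{x\in\partial\Omega:\pm b\,n(x)>0\}$ ($-$ inflow, $+$ outflow), and $H^1_-(\Omega)=\{w\in H^1(\Omega): w=0\text{ on }\partial_-\Omega\}$. Mesh: $\mathcal{T}_h$ is a finite division of $\Omega$ into non-overlapping intervals covering $\Omega$, shape regular in the sense that any two neighboring intervals have comparable lengths up to a constant $\kappa_{\mathcal{T}_h}$. The set of vertices is $\mathcal{V}_h=\mathcal{V}_h^{\mathrm{int}}\cup\mathcal{V}_h^{\partial_-\Omega}\cup\mathcal{V}_h^{\partial_+\Omega}$ (interior, inflow and outflow vertices). For $a\in\mathcal{V}_h$, $\mathcal{T}_a$ is the set of elements having $a$ as a vertex, $\omega_a$ the corresponding open interval, and $\psi_a$ the continuous piecewise affine hat function equal to $1$ at $a$ and $0$ at all other vertices. $\mathcal{P}^{m}(\mathcal{T})$ denotes piecewise polynomials of degree at most $m$ on $\mathcal{T}$ (no continuity imposed), and $\mathcal{P}^{m}(K)$ polynomials of degree at most $m$ on $K$. The local solutions $s_h^a$ exist and are unique; products $\psi_a s_h^a$ are extended by zero outside $\omega_a$. *)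

(* Defs.v *)
From HB Require Import structures.
From mathcomp Require Import all_boot all_order all_algebra.
From mathcomp Require Import all_classical all_reals all_analysis.

Set Implicit Arguments.
Unset Strict Implicit.
Unset Printing Implicit Defensive.

Import Order.TTheory GRing.Theory Num.Theory.
Import numFieldNormedType.Exports.

Local Open Scope classical_set_scope.
Local Open Scope ring_scope.

(* Elements of L_2(D) are represented by functions on the whole line; only    *)
(* their values almost everywhere on D matter.                                *)
Section function_spaces.
Context {R : realType}.
Implicit Types (D : set R) (v w g : R -> R).

Definition L2 D w : Prop := w \_ D \in Lfun (@lebesgue_measure R) 2%:E.

Definition inner D v w : R :=
  \int[@lebesgue_measure R]_(x in D) (v x * w x).

(* C_c^oo(D) *)
Definition test_function D (phi : R -> R) : Prop :=
  (forall n x, derivable (phi^`(n))%classic x 1) /\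
  let supp := closure [set x | phi x != 0] in compact supp /\ supp `<=` D.

Definition weak_derivative D w g : Prop :=
  L2 D g /\
  forall phi, test_function D phi -> inner D w (phi^`())%classic = - inner D g phi.

Definition H1 D w : Prop := L2 D w /\ exists g, weak_derivative D w g.

(* The weak derivative is unique up to a null set; one representative is      *)
(* chosen, and the value is the zero function if there is none.               *)
Definition grad D w : R -> R := xget (cst 0) [set g | weak_derivative D w g].

Definition outward_normal (alpha : R) (x : R) : R := if x == alpha then -1 else 1.

Definition inflow (alpha beta b : R) : set R :=
  [set x | (x = alpha \/ x = beta) /\ b * outward_normal alpha x < 0].

(* Boundary values are those of the continuous representative.                *)
Definition H1_inflow (alpha beta b : R) w : Prop :=
  H1 `]alpha, beta[ w /\
  exists wc : R -> R,
    [/\ {within `[alpha, beta], continuous wc},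
        {ae @lebesgue_measure R, forall x, x \in `]alpha, beta[ -> w x = wc x} &
        forall x, inflow alpha beta b x -> wc x = 0].

End function_spaces.

(* The vertices are node 0 < ... < node nb_elt; the values node i for         *)
(* i > nb_elt are irrelevant.                                                 *)
Record mesh (R : realType) (alpha beta : R) := Mesh {
  nb_elt : nat;
  node : nat -> R;
  shape_cst : R;
  node_first : node 0 = alpha;
  node_last : node nb_elt = beta;
  node_lt : forall i, (i < nb_elt)%N -> node i < node i.+1;
  shape_regular : forall i, (i.+1 < nb_elt)%N ->
    node i.+1 - node i <= shape_cst * (node i.+2 - node i.+1) /\
    node i.+2 - node i.+1 <= shape_cst * (node i.+1 - node i)
}.

Section mesh_notions.
Context {R : realType} {alpha beta : R} (T : mesh alpha beta).

Definition vertex := 'I_(nb_elt T).+1.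
Definition element := 'I_(nb_elt T).

Definition elt (j : element) : set R := `]node T j, node T j.+1[.

Definition elts_at (a : vertex) : pred element :=
  [pred j : element | (j == a :> nat) || (j.+1 == a :> nat)].

(* The truncations a.-1 and minn reduce the patch of a boundary vertex to its *)
(* single element.                                                            *)
Definition omega (a : vertex) : set R :=
  `]node T a.-1, node T (minn a.+1 (nb_elt T))[.

Definition hat (a : vertex) (x : R) : R :=
  if (a < nb_elt T)%N && (node T a <= x <= node T a.+1) then
    (node T a.+1 - x) / (node T a.+1 - node T a)
  else if (0 < a)%N && (node T a.-1 <= x <= node T a) then
    (x - node T a.-1) / (node T a - node T a.-1)
  else 0.

(* Values at the vertices are left free.                                      *)
Definition broken_poly (m : nat) (E : pred element) (w : R -> R) : Prop :=
  forall j, E j -> exists2 p : {poly R}, (size p <= m.+1)%N &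
    forall x, elt j x -> w x = p.[x].

Definition interior_vertex (a : vertex) : Prop := `]alpha, beta[%classic (node T a).

Definition inflow_vertex (b : R) (a : vertex) : Prop :=
  inflow alpha beta b (node T a).

Definition local_solution (b : R) (f uh : R -> R) (k : nat) (a : vertex)
    (sa : R -> R) : Prop :=
  [/\ broken_poly k (elts_at a) sa,
      H1 (omega a) sa &
      forall vh, broken_poly k (elts_at a) vh ->
        inner (omega a) (b \*o grad (omega a) (hat a \* sa)) vh =
        inner (omega a)
          (f \* hat a \+ (b \*o grad (omega a) (hat a)) \* uh) vh].

Definition reconstruction (s : vertex -> R -> R) (x : R) : R :=
  \sum_(a : vertex) ((hat a \* s a) \_ (omega a)) x.

End mesh_notions.

(* Main.v *)
Require Import Defs.
From mathcomp Require Import all_boot all_order all_algebra.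
From mathcomp Require Import all_classical all_reals all_analysis.
From mathcomp Require Import measurable_realfun ring lra zify.
Import Order.TTheory GRing.Theory Num.Theory.
Import numFieldNormedType.Exports.

(** On an element K = ]x_i, x_(i+1)[ only the two hat functions of the endpoints
    live, and they sum to 1. Since the local test functions may be discontinuous
    across elements, the two local problems that see K hold on K alone, against
    polynomials of degree at most k' ([local_element_eq]). Adding them, the hats
    sum to 1 in front of f, and their gradients sum to 0 in front of u_h: what
    remains is the orthogonality of f - b s_h' to these polynomials.

    Conformity of s_h is a matter of vertex values. Membership of s_a in H^1 of
    its patch forces its two polynomials to agree at the vertex a
    ([weak_derivative_matching]), and the hats vanish at the outer end of each
    element of the patch; hence the two polynomials of s_h next to an inner
    vertex a both take there the value of s_a, and a piecewise polynomial without
    jumps has its elementwise derivative as weak derivative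
    ([matching_weak_derivative]). At the inflow vertex a, testing the local
    problem with the constant 1 gives on the left b times the increment of
    psi_a s_a over the single element of the patch, that is plus or minus b times
    the inflow value of s_h, and on the right the hypothesis on u_h at a, that is
    zero.

    Gradients are arbitrarily chosen weak derivatives, so all this needs them to
    be identified almost everywhere with the elementwise derivatives
    ([weak_derivative_poly]). That is the fundamental lemma of the calculus of
    variations ([orthogonal_test_ae0]): an integrable function orthogonal to all
    test functions has zero integral over every subinterval, because smooth bumps
    built from exp(-1/x) increase to indicator functions; its primitive is then
    constant, and Lebesgue differentiation concludes. *)

Set Implicit Arguments.
Unset Strict Implicit.
Unset Printing Implicit Defensive.

Local Open Scope classical_set_scope.
Local Open Scope ring_scope.

(** * Smooth bump functions *)

Section smooth_functions.
Context {R : realType}.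
Implicit Types (f g : R -> R) (P : {poly R}) (x y c d k : R).

(** The family [flat P] is closed under differentiation, which is why the flat
    function exp(-1/x) is taken together with its polynomial multiples in 1/x. *)
Definition flat P x : R := if 0 < x then P.[x^-1] * expR (- x^-1) else 0.

Lemma exp_dominates_poly P :
  exists2 C, 0 <= C & forall y, 0 <= y -> `|P.[y]| <= C * expR y.
Proof.
have pow n y : 0 <= y -> y ^+ n <= n%:R ^+ n * expR y.
  case: n => [|n] y0; first by rewrite !expr0 mul1r -expR0 ler_expR.
  have -> : y = n.+1%:R * (y / n.+1%:R) by rewrite mulrC divfK ?pnatr_eq0.
  rewrite exprMn expRM_natl ler_wpM2l ?exprn_ge0// lerXn2r ?nnegrE ?expR_ge0//.
    by rewrite divr_ge0.
  by apply: le_trans (expR_ge1Dx _); rewrite lerDr.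
exists (\sum_(i < size P) `|P`_i| * i%:R ^+ i).
  by apply: sumr_ge0 => i _; rewrite mulr_ge0// exprn_ge0.
move=> y y0; rewrite horner_coef (le_trans (ler_norm_sum _ _ _))// mulr_suml.
apply: ler_sum => i _; rewrite normrM normrX (ger0_norm y0) -mulrA.
by rewrite ler_wpM2l// pow.
Qed.

Lemma is_derive_flat0 P : is_derive (0 : R) 1 (flat P) 0.
Proof.
have [C C0 bC] := exp_dominates_poly (P * 'X^2).
(* exp(1/h) dominates P(1/h) / h^2, so that [flat P] is O(h^2) at 0. *)
have bnd h : `|flat P h| <= C * h ^+ 2.
  rewrite /flat; case: ifPn => [h0|_]; last by rewrite normr0 mulr_ge0// sqr_ge0.
  have hV : 0 < h^-1 by rewrite invr_gt0.
  have := bC _ (ltW hV).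
  rewrite hornerM hornerXn normrM normrX (gtr0_norm hV) exprVn => b1.
  rewrite normrM (gtr0_norm (expR_gt0 _)) expRN ler_pdivrMr ?expR_gt0//.
  by rewrite mulrAC -ler_pdivrMr ?exprn_gt0.
suff : h^-1 *: ((flat P \o shift 0) (h *: 1) - flat P 0) @[h --> 0^'] --> (0 : R).
  by move=> fl; split; [apply/cvg_ex; exists 0|exact/cvg_lim].
apply/cvgr0Pnorm_le => e e0; near=> h.
have h0 : 0 < `|h| by rewrite normr_gt0; near: h; exact: nbhs_dnbhs_neq.
rewrite [flat P 0]/flat ltxx subr0 /= /shift /= addr0 [h *: 1]mulr1.
rewrite normrZ normfV mulrC ler_pdivrMr//.
apply: (le_trans (bnd h)).
rewrite -[h ^+ 2]ger0_norm ?sqr_ge0// normrX expr2 mulrA ler_wpM2r ?normr_ge0//.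
rewrite (@le_trans _ _ ((C + 1) * `|h|))//; first by rewrite ler_wpM2r// lerDl.
rewrite mulrC -ler_pdivlMr ?ltr_wpDl//.
near: h; apply: dnbhs0_le; rewrite divr_gt0// ltr_wpDl//.
Unshelve. all: by end_near. Qed.

Lemma is_derive_flat P x :
  is_derive x 1 (flat P) (flat ('X^2 * (P - P^`())) x).
Proof.
have [x0|x0|->] := ltgtP x 0; last first.
- by rewrite {2}/flat ltxx; exact: is_derive_flat0.
- apply: (@near_eq_is_derive _ _ _ (fun y => P.[y^-1] * expR (- y^-1))).
    near=> y; rewrite /flat ifT//; near: y; exact: lt_nbhsr.
  rewrite /flat x0.
  have xN0 : x != 0 by rewrite gt_eqF.
  have dV : is_derive x 1 (fun y : R => y^-1) (- x ^- 2).
    by have := is_deriveV xN0 (is_derive_id x 1); rewrite [_ *: 1]mulr1.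
  have dP : is_derive x 1 (fun y => P.[y^-1]) (P^`().[x^-1] * (- x ^- 2)).
    exact: (@is_derive1_comp _ (horner P) (fun y => y^-1)).
  have dE : is_derive x 1 (fun y => expR (- y^-1)) (expR (- x^-1) * x ^- 2).
    apply: (@is_derive1_comp _ expR (fun y => - y^-1)).
    by have := is_deriveN dV; rewrite opprK.
  apply: is_derive_eq.
  rewrite hornerM hornerXn hornerD hornerN exprVn.
  rewrite /GRing.scale/=; ring.
- apply: (@near_eq_is_derive _ _ _ (fun=> 0)).
    near=> y; rewrite /flat ifF//; apply/negbTE; rewrite -leNgt ltW//.
    by near: y; exact: lt_nbhsl.
  by rewrite /flat ifF ?(lt_gtF x0)//; exact: is_derive_cst.
Unshelve. all: by end_near. Qed.

(** Iterated derivatives are controlled by structural induction: the derivative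
    of a member of this class is again a member of it, so each member is
    infinitely differentiable without any formula for its n-th derivative. *)
Inductive smooth : (R -> R) -> Prop :=
| smooth_flat P c d : smooth (fun x => flat P (c * x + d))
| smooth_cst c : smooth (fun=> c)
| smooth_add f g : smooth f -> smooth g -> smooth (fun x => f x + g x)
| smooth_mul f g : smooth f -> smooth g -> smooth (fun x => f x * g x).

Lemma smooth_deriv f : smooth f ->
  exists2 g, smooth g & forall x, is_derive x 1 f (g x).
Proof.
elim=> {f} [P c d|c|f g _ [f' sf' df] _ [g' sg' dg]
  |f g sf [f' sf' df] sg [g' sg' dg]].
- exists (fun x => flat ('X^2 * (P - P^`())) (c * x + d) * c).
    by apply: smooth_mul; [exact: smooth_flat|exact: smooth_cst].
  move=> x; apply: (@is_derive1_comp _ (flat P) (fun x => c * x + d)).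
    exact: is_derive_flat.
  apply: is_derive_eq; rewrite addr0 [c *: 1]mulr1 //.
- by exists (fun=> 0); [exact: smooth_cst|move=> x; exact: is_derive_cst].
- exists (fun x => f' x + g' x); first exact: smooth_add.
  by move=> x; exact: is_deriveD.
- exists (fun x => f x * g' x + g x * f' x).
    by apply: smooth_add; apply: smooth_mul.
  by move=> x; exact: is_deriveM.
Qed.

Lemma smooth_derivable f n x : smooth f -> derivable (f^`(n))%classic x 1.
Proof.
move=> sf; suff [g sg ->] : exists2 g, smooth g & (f^`(n))%classic = g.
  by have [g' _ /(_ x)[]] := smooth_deriv sg.
elim: n => [|n [g sg fg]]; first by exists f.
have [g' sg' dg] := smooth_deriv sg; exists g' => //.
by rewrite derive1nS fg; apply/funext => y; rewrite derive1E; have [_ ->] := dg y.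
Qed.

(** The dilation factor [k] makes a single formula serve two purposes: for k > 0
    the bump vanishes exactly outside ]c, d[, and as [k] tends to infinity the
    bumps tend to the indicator function of ]c, d[. *)
Definition bump c d k x : R :=
  flat 1 (k * x + - (k * c)) * flat 1 ((- k) * x + k * d).

Let flat1_ge0_le1 x : 0 <= flat 1 x <= 1.
Proof.
rewrite /flat; case: ifPn => [x0|_]; last by rewrite lexx ler01.
by rewrite hornerC mul1r expR_ge0/= -[leRHS]expR0 ler_expR oppr_le0 invr_ge0 ltW.
Qed.

Let flat1_neq0 x : (flat 1 x != 0) = (0 < x).
Proof.
rewrite /flat; case: ifPn => [x0|_]; last by rewrite eqxx.
by rewrite hornerC mul1r gt_eqF ?expR_gt0.
Qed.

Lemma bump_ge0_le1 c d k x : 0 <= bump c d k x <= 1.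
Proof.
have /andP[a0 a1] := flat1_ge0_le1 (k * x + - (k * c)).
have /andP[b0 b1] := flat1_ge0_le1 ((- k) * x + k * d).
by rewrite mulr_ge0//= mulr_ile1.
Qed.

Lemma bump_neq0 c d k x : 0 < k -> (bump c d k x != 0) = (c < x < d).
Proof.
move=> k0; rewrite mulf_eq0 negb_or !flat1_neq0 mulNr (addrC (- _)).
by rewrite !subr_gt0 !ltr_pM2l.
Qed.

Lemma bump_smooth c d k : smooth (bump c d k).
Proof. by apply: smooth_mul; exact: smooth_flat. Qed.

Lemma test_function_bump (D : set R) c d k :
  0 < k -> `[c, d] `<=` D -> test_function D (bump c d k).
Proof.
move=> k0 cdD; split=> [n x|]; first exact/smooth_derivable/bump_smooth.
set supp := closure _; have sub : supp `<=` `[c, d].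
  have /closure_id-> : closed `[c, d] by exact: itv_closed.
  apply: closureS => x /=; rewrite bump_neq0// in_itv/= => /andP[cx xd].
  by rewrite !ltW.
split; last exact: subset_trans sub cdD.
apply: (subclosed_compact _ (@segment_compact _ c d)) => //.
exact: closed_closure.
Qed.

Lemma cvg_bump c d x : bump c d n.+1%:R x @[n --> \oo] --> (\1_`]c, d[ x : R).
Proof.
have cvg_flat y : 0 < y -> flat 1 (n.+1%:R * y) @[n --> \oo] --> (1 : R).
  move=> y0.
  have -> : (fun n : nat => flat 1 (n.+1%:R * y)) =
            expR \o (fun n => harmonic n * - y^-1).
    apply/funext => n /=; rewrite /flat ifT ?mulr_gt0// hornerC mul1r.
    by rewrite invfM mulrN.
  rewrite -expR0; apply: continuous_cvg; first exact: continuous_expR.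
  by rewrite -(mul0r (- y^-1)); apply: cvgMl; exact: cvg_harmonic.
rewrite indicE; have [xcd|xcd] := boolP (x \in _); last first.
  apply: cvg_near_cst; apply: nearW => n; apply/eqP.
  move: xcd; rewrite mem_setE in_itv/=; apply: contraNT.
  by rewrite bump_neq0.
move: xcd; rewrite mem_setE in_itv/= => /andP[cx xd].
rewrite -(mulr1 1%:R); under eq_cvg do rewrite /bump mulNr (addrC (- _)) -!mulrBr.
by apply: cvgM; apply: cvg_flat; rewrite subr_gt0.
Qed.

End smooth_functions.

(** * Square-integrable functions *)

Section L2_facts.
Context {R : realType}.
Notation mu := (@lebesgue_measure R).
Implicit Types (D E : set R) (v w g : R -> R) (a b : R).

Lemma L2_measurable D w : measurable D -> L2 D w -> measurable_fun D w.
Proof.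
move=> mD; rewrite /L2 inE => /andP[+ _]; rewrite inE/= => mw.
by apply/(measurable_restrictT _ mD).
Qed.

Lemma sqr_integrable_L2 D w : measurable D -> measurable_fun D w ->
  mu.-integrable D (EFin \o (fun x => w x ^+ 2)) -> L2 D w.
Proof.
move=> mD mw iw; rewrite /L2 inE; apply/andP.
have mw' : measurable_fun setT (w \_ D) by apply/(measurable_restrictT _ mD).
split; rewrite inE/=; first exact: mw'.
rewrite /finite_norm unlock poweR_lty//.
rewrite (_ : (fun x => _) = (EFin \o (fun x => w x ^+ 2)) \_ D); last first.
  apply/funext => x /=; rewrite !patchE; case: ifPn => //= _.
    by rewrite powR_mulrn// -normrX ger0_norm ?sqr_ge0.
  by rewrite normr0 powR0.
by apply: integrable_lty => //; rewrite -integrable_mkcond.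
Qed.

Lemma L2_sqr_integrable D w : measurable D -> L2 D w ->
  mu.-integrable D (EFin \o (fun x => w x ^+ 2)).
Proof.
move=> mD /Lfun2_integrable_sqr iw; apply/integrable_mkcond => //.
rewrite restrict_EFin (_ : _ \_ D = (fun x => (w \_ D) x ^+ 2))//.
by apply/funext => x; rewrite !patchE; case: ifPn => //; rewrite expr0n.
Qed.

Lemma bounded_L2 D w (M : R) :
  measurable D -> (mu D < +oo)%E -> measurable_fun D w ->
  (forall x, D x -> `|w x| <= M) -> L2 D w.
Proof.
move=> mD fD mw wM; apply: sqr_integrable_L2 => //.
apply: measurable_bounded_integrable => //; first exact: measurable_funX.
exists (M ^+ 2); split; first exact: num_real.
move=> N MN x Dx /=; rewrite (le_trans _ (ltW MN))// normrX.
by rewrite lerXn2r ?nnegrE ?wM//; exact: le_trans (wM x Dx).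
Qed.

Lemma L2S D E w : measurable D -> measurable E -> E `<=` D -> L2 D w -> L2 E w.
Proof.
move=> mD mE ED lw; apply: sqr_integrable_L2 => //.
  by apply: measurable_funS (L2_measurable mD lw).
by apply: integrableS (L2_sqr_integrable mD lw).
Qed.

Lemma L2_mul_integrable D v w : measurable D -> L2 D v -> L2 D w ->
  mu.-integrable D (EFin \o (v \* w)).
Proof.
move=> mD lv lw; apply/integrable_mkcond => //; rewrite restrict_EFin.
have -> : (v \* w) \_ D = (v \_ D) \* (w \_ D).
  by apply/funext => x /=; rewrite !patchE; case: ifPn; rewrite ?mulr0.
exact/Lfun1_integrable/Lfun2_mul_Lfun1.
Qed.

Lemma mu_itvoo_fin a b : (mu `]a, b[ < +oo)%E.
Proof.
by rewrite lebesgue_measure_itv/=; case: ifP => // _; rewrite -EFinB ltry.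
Qed.

Lemma L2_integrable a b g : L2 `]a, b[ g ->
  mu.-integrable `]a, b[ (EFin \o g).
Proof.
move=> lg; have -> : g = g \* cst 1 by apply/funext => x /=; rewrite mulr1.
apply: L2_mul_integrable => //; apply: (@bounded_L2 _ _ 1) => //.
  exact: mu_itvoo_fin.
by move=> x _; rewrite normr1.
Qed.

Lemma continuous_L2 a b v : continuous v -> L2 `]a, b[ v.
Proof.
move=> cv; have [ab|ba] := leP a b; last first.
  apply: (@bounded_L2 _ _ 0) => //; [exact: mu_itvoo_fin| |].
    by apply: measurable_funTS; exact: continuous_measurable_fun.
  move=> x /=; rewrite in_itv/= => /andP[ax xb].
  by have := lt_trans (lt_trans ax xb) ba; rewrite ltxx.
have [c _ cmax] : exists2 c, c \in `[a, b]%R &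
    forall t, t \in `[a, b]%R -> `|v t| <= `|v c|.
  apply: (@EVT_max _ (fun t => `|v t|)) => //.
  apply: continuous_subspaceT => x; apply: continuous_comp; first exact: cv.
  exact: norm_continuous.
apply: (@bounded_L2 _ _ `|v c|) => //; first exact: mu_itvoo_fin.
  by apply: measurable_funTS; exact: continuous_measurable_fun.
move=> x /=; rewrite in_itv/= => /andP[ax xb]; apply: cmax.
by rewrite in_itv/= !ltW.
Qed.

Lemma horner_continuous (p : {poly R}) : continuous (horner p).
Proof.
move=> x; have [d _] := is_derive_poly p x.
exact/differentiable_continuous/derivable1_diffP.
Qed.

Lemma horner_L2 a b (p : {poly R}) : L2 `]a, b[ (horner p).
Proof. by apply: continuous_L2; exact: horner_continuous. Qed.

Lemma integral_EFin D g : measurable D -> mu.-integrable D (EFin \o g) ->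
  (\int[mu]_(x in D) (g x)%:E)%E = (\int[mu]_(x in D) g x)%:E.
Proof.
by move=> mD ig; rewrite /Rintegral fineK//; exact: integrable_fin_num.
Qed.

Lemma Rintegral_support D E g : E `<=` D ->
  (forall x, D x -> ~ E x -> g x = 0) ->
  \int[mu]_(x in D) g x = \int[mu]_(x in E) g x.
Proof.
move=> ED g0; rewrite Rintegral_mkcond [RHS]Rintegral_mkcond.
congr (Rintegral _ _ _); apply/funext => x; rewrite !patchE.
case: ifPn => [/set_mem Dx|nDx]; case: ifPn => [/set_mem Ex|nEx] //.
- by apply: g0 => // Ex; move: nEx; rewrite mem_set.
- by move: nDx; rewrite mem_set//; exact: ED.
Qed.

Lemma ae_imply (P Q : R -> Prop) : (forall t, P t -> Q t) ->
  {ae mu, forall t, P t} -> {ae mu, forall t, Q t}.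
Proof.
by move=> PQ; apply: filterS => //; exact: (ae_filter_ringOfSetsType mu).
Qed.

Lemma ae_eq_Rintegral a b v w :
  measurable_fun `]a, b[ v -> measurable_fun `]a, b[ w ->
  {ae mu, forall t, t \in `]a, b[ -> v t = w t} ->
  \int[mu]_(t in `]a, b[) v t = \int[mu]_(t in `]a, b[) w t.
Proof.
move=> mv mw vw; rewrite /Rintegral; congr fine; apply: ae_eq_integral => //.
- exact/measurable_EFinP.
- exact/measurable_EFinP.
- by apply: ae_imply vw => t vw /= /vw ->.
Qed.

End L2_facts.

(** * Test functions *)

Section test_functions.
Context {R : realType}.
Notation mu := (@lebesgue_measure R).
Implicit Types (D E : set R) (v w g phi : R -> R) (a b c d k : R).

Lemma test_functionS D E phi :
  E `<=` D -> test_function E phi -> test_function D phi.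
Proof.
by move=> ED [sm [cs sE]]; do 2 split=> //; exact: subset_trans sE ED.
Qed.

Lemma test_function_out D phi x : test_function D phi -> ~ D x ->
  phi x = 0 /\ (phi^`())%classic x = 0.
Proof.
move=> [_ [_ sD]] nDx; set supp := closure _ in sD.
have osupp : open (~` supp) by apply: closed_openC; exact: closed_closure.
have xs : (~` supp) x by move=> /sD.
have phi0 y : (~` supp) y -> phi y = 0.
  move=> ys; apply/eqP; apply: contrapT => /negP y0.
  by apply: ys; exact: subset_closure.
split; first exact: phi0.
rewrite derive1E -[RHS](derive_cst (0 : R) x 1); apply: near_eq_derive.
near=> y; apply: phi0; near: y; exact: open_nbhs_nbhs.
Unshelve. all: by end_near. Qed.

Lemma test_function_ends a b phi : test_function `]a, b[ phi ->
  phi a = 0 /\ phi b = 0.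
Proof.
move=> tphi; split; apply: (test_function_out tphi _).1;
  by rewrite /= in_itv/= ltxx ?andbF.
Qed.

Lemma test_function_continuous D phi : test_function D phi ->
  continuous phi /\ continuous (phi^`())%classic.
Proof.
move=> [sm _]; split=> x; apply/differentiable_continuous/derivable1_diffP.
  exact: (sm 0%N).
exact: (sm 1%N).
Qed.

(** Dominated convergence along the bumps, whose limit is the indicator function
    of ]c, d[. *)
Lemma orthogonal_test_itv0 a b c d g :
  mu.-integrable `]a, b[ (EFin \o g) ->
  (forall phi, test_function `]a, b[ phi -> inner `]a, b[ g phi = 0) ->
  a < c -> d < b -> \int[mu]_(x in `]c, d[) g x = 0.
Proof.
move=> ig g0 ac db.
have mg : measurable_fun `]a, b[ g.
  by apply/measurable_EFinP; exact: measurable_int ig.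
have tb n : test_function `]a, b[ (bump c d n.+1%:R).
  apply: test_function_bump => // x /=; rewrite !in_itv/= => /andP[cx xd].
  by rewrite (lt_le_trans ac cx) (le_lt_trans xd db).
have mb n : measurable_fun `]a, b[ (bump c d n.+1%:R).
  apply: measurable_funTS; apply: continuous_measurable_fun.
  by have [] := test_function_continuous (tb n).
have mgb n : measurable_fun `]a, b[ (g \* bump c d n.+1%:R).
  exact: measurable_funM.
have dom n x : (`|(g x * bump c d n.+1%:R x)%:E| <= `|(g x)%:E|)%E.
  rewrite lee_fin normrM; have /andP[b0 b1] := bump_ge0_le1 c d n.+1%:R x.
  by rewrite ler_piMr// ger0_norm.
have igb n : mu.-integrable `]a, b[ (EFin \o (g \* bump c d n.+1%:R)).
  apply: le_integrable ig => //; first by apply/measurable_EFinP; exact: mgb.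
  by move=> x _; exact: dom.
have mgi : measurable_fun `]a, b[ (fun x => g x * \1_`]c, d[ x : R).
  by apply: measurable_funM => //; exact: measurable_indic.
have [] := @dominated_convergence _ _ _ mu `]a, b[ (measurable_itv _)
  (fun n x => (g x * bump c d n.+1%:R x)%:E) (fun x => (g x * \1_`]c, d[ x)%:E)
  (fun x => `|(g x)%:E|%E).
- by move=> n; apply/measurable_EFinP; exact: mgb.
- by apply/measurable_EFinP.
- apply: aeW => x _; apply: cvg_EFin; first exact: nearW.
  apply: cvgM; [exact: cvg_cst|exact: cvg_bump].
- exact: integrable_abse.
- by apply: aeW => x n _; exact: dom.
have int0 n : (\int[mu]_(x in `]a, b[) (g x * bump c d n.+1%:R x)%:E = 0)%E.
  exact: etrans (integral_EFin (measurable_itv _) (igb n))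
    (congr1 EFin (g0 _ (tb n))).
move=> ifin _ lim_int.
have : (\int[mu]_(x in `]a, b[) (g x * \1_`]c, d[ x)%:E = 0)%E.
  apply: cvg_unique lim_int _; first exact: ereal_hausdorff.
  by apply: cvg_near_cst; apply: nearW => n; exact: int0.
rewrite integral_EFin// => -[] <-.
rewrite (@Rintegral_support R `]a, b[ `]c, d[).
- by apply: eq_Rintegral => x xcd; rewrite indicE xcd mulr1.
- move=> x /=; rewrite !in_itv/= => /andP[cx xd].
  by rewrite (lt_trans ac cx) (lt_trans xd db).
- by move=> x _ xcd; rewrite indicE memNset ?mulr0.
Qed.

(** This is the fundamental lemma of the calculus of variations; weak
    derivatives are unique up to a null set because of it. *)
Lemma orthogonal_test_ae0 a b g : mu.-integrable `]a, b[ (EFin \o g) ->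
  (forall phi, test_function `]a, b[ phi -> inner `]a, b[ g phi = 0) ->
  {ae mu, forall x, x \in `]a, b[ -> g x = 0}.
Proof.
move=> ig g0; pose G := g \_ `]a, b[.
have iG : mu.-integrable setT (EFin \o G).
  by rewrite -restrict_EFin -integrable_mkcond.
(* By the previous lemma the primitive of [G] is constant on ]a, b[, and its
   derivative is [G] almost everywhere. *)
pose F x := \int[mu]_(t in `]-oo, x]) G t.
have Fcst y z : a < y -> y < z -> z < b -> F z = F y.
  move=> ay yz zb; apply/eqP; rewrite -subr_eq0 /F Rintegral_itvB//; last 2 first.
    by apply: integrableS iG.
    by rewrite bnd_simp ltW.
  rewrite -Rintegral_itv_bndo_bndc; last exact: integrableS iG.
  rewrite -(orthogonal_test_itv0 ig g0 ay zb); apply/eqP/eq_Rintegral => t.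
  rewrite inE/= in_itv/= => /andP[yt tz]; rewrite /G patchE ifT// inE/= in_itv/=.
  by rewrite (lt_trans ay yt) (lt_trans tz zb).
have iGNy y : mu.-integrable `]-oo, y] (EFin \o G) by exact: integrableS iG.
have locG : locally_integrable setT G.
  exact: integrable_locally.
have := FTC1Ny iGNy locG.
apply: ae_imply => x [_ Fx]; rewrite in_itv/= => /andP[ax xb].
have <- : G x = g x by rewrite /G patchE ifT// inE/= in_itv/= ax.
rewrite -Fx derive1E -[RHS](derive_cst (F x) x 1).
apply: near_eq_derive; near=> y => /=.
have ay : a < y by near: y; exact: lt_nbhsr.
have yb : y < b by near: y; exact: lt_nbhsl.
have [xy|yx|->//] := ltgtP x y; first exact: Fcst.
exact/esym/Fcst.
Unshelve. all: by end_near. Qed.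

Lemma inner_testS D E w phi : E `<=` D -> test_function E phi ->
  inner D w phi = inner E w phi /\
  inner D w (phi^`())%classic = inner E w (phi^`())%classic.
Proof.
move=> ED tphi; split; apply: Rintegral_support => // x _ nEx;
  have [p0 dp0] := test_function_out tphi nEx; by rewrite (p0, dp0) mulr0.
Qed.

Lemma weak_derivativeS D E w g : measurable D -> measurable E -> E `<=` D ->
  weak_derivative D w g -> weak_derivative E w g.
Proof.
move=> mD mE ED [lg wg]; split; first exact: L2S lg.
move=> phi tphi; have := wg _ (test_functionS ED tphi).
by rewrite (inner_testS w ED tphi).2 (inner_testS g ED tphi).1.
Qed.

Lemma poly_integration_by_parts phi (p : {poly R}) c d : c < d ->
  (forall t, derivable phi t 1) -> continuous (phi^`())%classic ->
  \int[mu]_(t in `]c, d[) (p.[t] * (phi^`())%classic t) =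
  (p.[d] * phi d - p.[c] * phi c) - \int[mu]_(t in `]c, d[) (p^`().[t] * phi t).
Proof.
move=> cd dphi cdphi.
have cphi : continuous phi.
  by move=> t; exact/differentiable_continuous/derivable1_diffP.
have int_oo v : continuous v ->
    \int[mu]_(t in `]c, d[) v t = \int[mu]_(t in `[c, d]) v t.
  move=> cv; rewrite -Rintegral_itv_obnd_cbnd; last first.
    have icd : mu.-integrable `[c, d] (EFin \o v).
      apply: continuous_compact_integrable; first exact: segment_compact.
      exact: continuous_subspaceT.
    apply: integrableS icd => //.
      by apply: subset_itvr; rewrite bnd_simp.
  rewrite -Rintegral_itv_bndo_bndc//; exact/L2_integrable/continuous_L2.
have cp := @horner_continuous R p; have cp' := @horner_continuous R p^`().
have dLR v : (forall x, derivable v x 1) ->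
    derivable_oo_LRcontinuous v c d.
  move=> dv; have cv x : {for x, continuous v}.
    exact/differentiable_continuous/derivable1_diffP.
  split=> [x _||]; first exact: dv.
    exact/cvg_at_right_filter/cv.
  exact/cvg_at_left_filter/cv.
rewrite !int_oo; last 2 first.
- by move=> x; apply: cvgM; [exact: cp'|exact: cphi].
- by move=> x; apply: cvgM; [exact: cp|exact: cdphi].
apply: (@Rintegration_by_parts R (horner p) phi) => //.
- exact: continuous_subspaceT.
- by apply: dLR => x; have [] := is_derive_poly p x.
- by move=> x _; rewrite -derivE.
- exact: continuous_subspaceT.
- exact: dLR.
Qed.

Lemma test_integration_by_parts D phi (p : {poly R}) c d :
  test_function D phi -> c < d ->
  \int[mu]_(t in `]c, d[) (p.[t] * (phi^`())%classic t) =
  (p.[d] * phi d - p.[c] * phi c) - \int[mu]_(t in `]c, d[) (p^`().[t] * phi t).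
Proof.
move=> tphi cd; apply: poly_integration_by_parts => //; first exact: (tphi.1 0%N).
by have [] := test_function_continuous tphi.
Qed.

Lemma Rintegral_deriv_poly (p : {poly R}) c d : c < d ->
  \int[mu]_(t in `]c, d[) p^`().[t] = p.[d] - p.[c].
Proof.
move=> cd; have d1 : ((cst 1 : R -> R)^`())%classic = cst 0.
  by apply/funext => t; rewrite derive1_cst.
have d1R t : derivable (cst 1 : R -> R) t 1 by exact: derivable_cst.
have c0 : continuous (cst 0 : R -> R) by exact: cst_continuous.
have := @poly_integration_by_parts (cst 1) p c d cd d1R; rewrite d1 => /(_ c0).
under eq_Rintegral do rewrite mulr0.
under [X in _ - X]eq_Rintegral do rewrite mulr1.
by rewrite Rintegral_cst// mul0r !mulr1 => /esym/subr0_eq.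
Qed.

End test_functions.

(** * Piecewise polynomials *)

Section piecewise_polynomials.
Context {R : realType}.
Notation mu := (@lebesgue_measure R).
Variable x : nat -> R.
Implicit Types (m n i j : nat) (p : nat -> {poly R}) (v w g : R -> R).

Definition increasing m n := forall i, (m <= i < n)%N -> x i < x i.+1.

Definition piecewise m n p w :=
  forall i t, (m <= i < n)%N -> x i < t < x i.+1 -> w t = (p i).[t].

Definition matching m n p :=
  forall i, (m <= i)%N -> (i.+1 < n)%N -> (p i).[x i.+1] = (p i.+1).[x i.+1].

Lemma increasingS m n m' n' : (m <= m')%N -> (n' <= n)%N ->
  increasing m n -> increasing m' n'.
Proof.
move=> mm nn inc i /andP[mi im]; apply: inc.
by rewrite (leq_trans mm mi) (leq_trans im nn).
Qed.

Lemma piecewiseS m n m' n' p w : (m <= m')%N -> (n' <= n)%N ->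
  piecewise m n p w -> piecewise m' n' p w.
Proof.
move=> mm nn pw i t /andP[mi im]; apply: pw.
by rewrite (leq_trans mm mi) (leq_trans im nn).
Qed.

Lemma node_le m n i j : increasing m n ->
  (m <= i)%N -> (i <= j)%N -> (j <= n)%N -> x i <= x j.
Proof.
move=> inc mi; elim: j => [|j IH]; first by rewrite leqn0 => /eqP->.
rewrite leq_eqVlt => /predU1P[->//|]; rewrite ltnS => ij jn.
apply: (le_trans (IH ij (ltnW jn))); apply/ltW/inc.
by rewrite (leq_trans mi ij).
Qed.

Lemma node_itvS m n i j : increasing m n ->
  (m <= i)%N -> (i <= j)%N -> (j <= n)%N -> `]x i, x j[ `<=` `]x m, x n[.
Proof.
move=> inc mi ij jn; apply: subset_itv; rewrite bnd_simp.
  by apply: (node_le inc); rewrite ?leqnn// (leq_trans ij jn).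
by apply: (node_le inc); rewrite ?leqnn// (leq_trans mi ij).
Qed.

Lemma element_inj m n i j t : increasing m n ->
  (m <= i < n)%N -> (m <= j < n)%N ->
  x i < t < x i.+1 -> x j < t < x j.+1 -> i = j.
Proof.
move=> inc; wlog ij : i j / (i <= j)%N.
  move=> H ii jj ti tj; have [ij|/ltnW ji] := leqP i j; first exact: H.
  exact/esym/H.
move=> /andP[mi im] /andP[mj jn] /andP[_ ti] /andP[tj _].
move: ij; rewrite leq_eqVlt => /predU1P[//|ij].
have := node_le inc (leqW mi) ij (ltnW jn); rewrite leNgt => /negP[].
exact: lt_trans tj ti.
Qed.

Lemma piecewise_exists m n p : increasing m n -> exists g, piecewise m n p g.
Proof.
move=> inc.
exists (fun t =>
  \sum_(m <= i < n) if x i < t < x i.+1 then (p i).[t] else 0).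
move=> i t min ti; rewrite (bigD1_seq i) ?mem_index_iota ?iota_uniq//= ti.
rewrite big_nat_cond big1 ?addr0// => j /andP[mjn ji]; case: ifPn => // tj.
by move: ji; rewrite (element_inj inc mjn min tj ti) eqxx.
Qed.

Lemma piecewise_itv m n p w i : (m <= i < n)%N -> piecewise m n p w ->
  {in `]x i, x i.+1[%classic, w =1 horner (p i)}.
Proof. by move=> min pw t; rewrite inE/= in_itv/=; exact: pw. Qed.

Lemma ae_pieces m n (Q : R -> Prop) : (m <= n)%N ->
  (forall i, (m <= i < n)%N -> {ae mu, forall t, t \in `]x i, x i.+1[ -> Q t}) ->
  {ae mu, forall t, t \in `]x m, x n[ -> Q t}.
Proof.
elim: n => [|n IH].
  rewrite leqn0 => /eqP-> _; apply: aeW => t; rewrite in_itv/= => /andP[a b].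
  by have := lt_trans a b; rewrite ltxx.
rewrite leq_eqVlt => /predU1P[-> _|].
  apply: aeW => t; rewrite in_itv/= => /andP[a b].
  by have := lt_trans a b; rewrite ltxx.
rewrite ltnS => mn H.
have A1 : {ae mu, forall t, t \in `]x m, x n[ -> Q t}.
  by apply: IH => // i /andP[mi im]; apply: H; rewrite mi ltnS ltnW.
have A2 : {ae mu, forall t, t \in `]x n, x n.+1[ -> Q t} by apply: H; rewrite mn /=.
have A3 : {ae mu, forall t, t != x n}.
  exists [set x n]; split => //; first exact: lebesgue_measure_set1.
  by move=> t /= /negP; rewrite negbK => /eqP.
apply: (@filterS3 _ _ (ae_filter_ringOfSetsType mu) _ _ _ _ _ A1 A2 A3).
move=> t Q1 Q2 tN; rewrite in_itv/= => /andP[mt tn].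
have [tx|xt|tE] := ltgtP t (x n); last by rewrite tE eqxx in tN.
  by apply: Q1; rewrite in_itv/= mt.
by apply: Q2; rewrite in_itv/= xt.
Qed.

Lemma Rintegral_split (a b c : R) v : a <= b -> b < c ->
  mu.-integrable `]a, c[ (EFin \o v) ->
  \int[mu]_(t in `]a, c[) v t =
  \int[mu]_(t in `]a, b[) v t + \int[mu]_(t in `]b, c[) v t.
Proof.
move=> ab bc iv.
rewrite [X in _ = X + _]Rintegral_itv_bndo_bndc; last first.
  by apply: integrableS iv => //; apply: subset_itvl; rewrite bnd_simp ltW.
by rewrite -(@Rintegral_itvB _ v (BRight a) (BLeft c) b) ?bnd_simp// addrC subrK.
Qed.

Lemma Rintegral_pieces m n v : (m <= n)%N -> increasing m n ->
  mu.-integrable `]x m, x n[ (EFin \o v) ->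
  \int[mu]_(t in `]x m, x n[) v t =
  \sum_(m <= i < n) \int[mu]_(t in `]x i, x i.+1[) v t.
Proof.
elim: n => [|n IH].
  by rewrite leqn0 => /eqP-> _ _; rewrite big_geq// set_itvoo0 Rintegral_set0.
rewrite leq_eqVlt => /predU1P[-> _ _|].
  by rewrite big_geq// set_itvoo0 Rintegral_set0.
rewrite ltnS => mn inc iv; have incn : increasing m n by exact: increasingS inc.
have xmn := node_le incn (leqnn m) mn (leqnn n).
have xn : x n < x n.+1 by apply: inc; rewrite mn /=.
rewrite big_nat_recr//= -IH//; first exact: Rintegral_split.
by apply: integrableS iv => //; apply: subset_itvl; rewrite bnd_simp ltW.
Qed.

Lemma piecewise_L2 m n p w : (m <= n)%N -> increasing m n ->
  piecewise m n p w -> L2 `]x m, x n[ w.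
Proof.
move=> mn inc pw.
suff [mw [M wM]] : measurable_fun `]x m, x n[ w /\
    exists M : R, forall t, `]x m, x n[%classic t -> `|w t| <= M.
  by apply: bounded_L2 wM => //; exact: mu_itvoo_fin.
elim: n mn inc pw => [|n IH].
  rewrite leqn0 => /eqP-> _ _; rewrite set_itvoo0; split; last by exists 0.
  exact: measurable_fun_set0.
rewrite leq_eqVlt => /predU1P[-> _ _|].
  rewrite set_itvoo0; split; last by exists 0.
  exact: measurable_fun_set0.
rewrite ltnS => mn inc pw.
have [mw [M wM]] := IH mn (increasingS (leqnn m) (leqnSn n) inc)
  (piecewiseS (leqnn m) (leqnSn n) pw).
have sub : `]x m, x n.+1[ `<=` (`]x m, x n[ `|` [set x n]) `|` `]x n, x n.+1[.
  move=> t /=; rewrite !in_itv/= => /andP[mt tn].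
  have [tx|xt|->] := ltgtP t (x n); last by left; right.
    by left; left; rewrite mt.
  by right.
have wp t : `]x n, x n.+1[%classic t -> w t = (p n).[t].
  by rewrite /= in_itv/=; apply: pw; rewrite mn /=.
split.
  apply: measurable_funS sub _; first by repeat apply: measurableU.
  apply/measurable_funU => //; first exact: measurableU.
  split.
    by apply/measurable_funU => //; split=> //; exact: measurable_fun_set1.
  apply: (eq_measurable_fun (horner (p n))); first by move=> t /set_mem/wp.
  exact: L2_measurable (horner_L2 _ _ _).
have [C pC] : exists C : R, forall t, `]x n, x n.+1[%classic t -> `|(p n).[t]| <= C.
  have xn : x n <= x n.+1 by apply/ltW/inc; rewrite mn /=.
  have [c _ cmax] : exists2 c, c \in `[x n, x n.+1]%R &
      forall t, t \in `[x n, x n.+1]%R -> `|(p n).[t]| <= `|(p n).[c]|.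
    apply: (@EVT_max _ (fun t => `|(p n).[t]|)) => //.
    apply: continuous_subspaceT => t.
    apply: continuous_comp; last exact: norm_continuous.
    exact: horner_continuous.
  exists `|(p n).[c]| => t /=; rewrite in_itv/= => /andP[a b]; apply: cmax.
  by rewrite in_itv/= !ltW.
exists (Num.max M (Num.max `|w (x n)| C)) => t /sub[[/wM tM|->]|tn].
- by rewrite le_max tM.
- by rewrite !le_max lexx orbT.
- by rewrite (wp _ tn) !le_max (pC _ tn) !orbT.
Qed.

(** The jump polynomial p_(j+1) - p_j vanishes at the node x_(j+1), hence
    evaluating it at max(t, x_(j+1)) switches it on continuously when t passes
    that node. *)
Lemma continuous_version m n p : (m <= n)%N -> increasing m n ->
  matching m n p ->
  exists2 wc : R -> R, continuous wc & forall i t,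
    (m <= i < n)%N -> x i <= t <= x i.+1 -> wc t = (p i).[t].
Proof.
move=> mn inc mp.
exists (fun t => (p m).[t] +
  \sum_(m <= j < n.-1) (p j.+1 - p j).[Num.max t (x j.+1)]).
  move=> t; apply: continuousD; first exact: horner_continuous.
  apply: continuous_big t; first exact: add_continuous.
  move=> j _ {}t.
  apply: (@continuous_comp R R R (id \max cst (x j.+1))
    (horner (p j.+1 - p j))); last exact: horner_continuous.
  by apply: continuous_max; [exact: cvg_id|exact: cvg_cst].
move=> i t /andP[mi im] /andP[it ti].
rewrite (@big_cat_nat _ _ _ i)//=; last by move: im; lia.
rewrite (eq_big_nat _ _ (F2 := fun j => (p j.+1).[t] - (p j).[t])); last first.
  move=> j /andP[mj ji]; rewrite max_l ?hornerD ?hornerN//.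
  by apply: le_trans it; apply: node_le inc _ _ _ => //; [exact: leqW|exact: ltnW].
rewrite telescope_sumr// big_nat_cond big1 ?addr0 ?subrKC//.
move=> j /andP[/andP[ij jn] _]; rewrite max_r; last first.
  apply: (le_trans ti); apply: node_le inc _ _ _ => //; first exact: leqW.
  by move: jn; lia.
rewrite hornerD hornerN mp ?subrr//; first exact: leq_trans mi ij.
by move: jn; lia.
Qed.

End piecewise_polynomials.

(** * Weak derivatives of piecewise polynomials *)

Section weak_derivative_piecewise.
Context {R : realType}.
Notation mu := (@lebesgue_measure R).
Variable x : nat -> R.
Implicit Types (m n i j : nat) (p : nat -> {poly R}) (v w g : R -> R).

Lemma inner_piecewise_deriv m n p w D phi : (m <= n)%N -> increasing x m n ->
  piecewise x m n p w -> test_function D phi ->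
  inner `]x m, x n[ w (phi^`())%classic =
  \sum_(m <= i < n)
    ((p i).[x i.+1] * phi (x i.+1) - (p i).[x i] * phi (x i)) -
  \sum_(m <= i < n) \int[mu]_(t in `]x i, x i.+1[) ((p i)^`().[t] * phi t).
Proof.
move=> mn inc pw tphi; have [_ cdphi] := test_function_continuous tphi.
rewrite /inner Rintegral_pieces//; last first.
  by apply: L2_mul_integrable => //; [exact: piecewise_L2 pw|exact: continuous_L2].
rewrite -sumrB big_nat_cond [RHS]big_nat_cond; apply: eq_bigr => i /andP[min _].
rewrite -(test_integration_by_parts _ tphi (inc i min)).
by apply: eq_Rintegral => t /(piecewise_itv min pw) ->.
Qed.

Lemma inner_piecewise m n p w D phi : (m <= n)%N -> increasing x m n ->
  piecewise x m n p w -> test_function D phi ->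
  inner `]x m, x n[ w phi =
  \sum_(m <= i < n) \int[mu]_(t in `]x i, x i.+1[) ((p i).[t] * phi t).
Proof.
move=> mn inc pw tphi; have [cphi _] := test_function_continuous tphi.
rewrite /inner Rintegral_pieces//; last first.
  by apply: L2_mul_integrable => //; [exact: piecewise_L2 pw|exact: continuous_L2].
rewrite big_nat_cond [RHS]big_nat_cond; apply: eq_bigr => i /andP[min _].
by apply: eq_Rintegral => t /(piecewise_itv min pw) ->.
Qed.

Lemma matching_weak_derivative m n p w g : (m <= n)%N -> increasing x m n ->
  piecewise x m n p w -> matching x m n p ->
  piecewise x m n (fun i => (p i)^`()) g ->
  weak_derivative `]x m, x n[ w g.
Proof.
move=> mn inc pw mp pg; split; first exact: piecewise_L2 pg.
move=> phi tphi.
rewrite (inner_piecewise_deriv mn inc pw tphi) (inner_piecewise mn inc pg tphi).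
have [phim phin] := test_function_ends tphi.
(* Matching makes the boundary terms telescope; at the first node the value
   0 is a dummy, as [phi] vanishes there. *)
pose c i := phi (x i) * if i == m then 0 else (p i.-1).[x i].
rewrite (_ : \sum_(m <= i < n) _ = \sum_(m <= i < n) (c i.+1 - c i)).
  by rewrite telescope_sumr// /c phim phin !mul0r subrr sub0r.
rewrite big_nat_cond [RHS]big_nat_cond; apply: eq_bigr => i /andP[/andP[mi im] _].
rewrite /c gtn_eqF ?ltnS// mulrC; congr (_ - _).
have [->|im'] := eqVneq i m; first by rewrite phim mulr0 mul0r.
have m0i : (m < i)%N by rewrite ltn_neqAle eq_sym im'.
rewrite mulrC; congr (_ * _); case: i m0i im {mi im'} => // i mi im /=.
by rewrite mp.
Qed.

(** Elementwise integration by parts shows that the difference of [g] and p_i' is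
    orthogonal to every test function supported in the element [i]. *)
Lemma weak_derivative_poly m n p w g i : (m <= i < n)%N -> increasing x m n ->
  piecewise x m n p w -> weak_derivative `]x m, x n[ w g ->
  {ae mu, forall t, t \in `]x i, x i.+1[ -> g t = (p i)^`().[t]}.
Proof.
move=> min inc pw wg; have [mi im] := andP min.
have sub : `]x i, x i.+1[ `<=` `]x m, x n[.
  exact: node_itvS.
have [lg wgi] : weak_derivative `]x i, x i.+1[ w g.
  exact: weak_derivativeS wg.
have ig : mu.-integrable `]x i, x i.+1[ (EFin \o (fun t => g t - (p i)^`().[t])).
  rewrite (_ : EFin \o _ = (EFin \o g) \- (EFin \o horner (p i)^`()))%E//.
  by apply: integrableB => //; apply: L2_integrable => //; exact: horner_L2.
have orth phi : test_function `]x i, x i.+1[ phi ->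
    inner `]x i, x i.+1[ (fun t => g t - (p i)^`().[t]) phi = 0.
  move=> tphi; have [cphi cdphi] := test_function_continuous tphi.
  rewrite /inner; under eq_Rintegral do rewrite mulrBl.
  rewrite RintegralB//; last 2 first.
  - by apply: L2_mul_integrable => //; exact: continuous_L2.
  - by apply: L2_mul_integrable; [|exact: horner_L2|exact: continuous_L2].
  have := test_integration_by_parts (p i) tphi (inc i min).
  have [-> ->] := test_function_ends tphi.
  rewrite !mulr0 subrr sub0r.
  have -> : \int[mu]_(t in `]x i, x i.+1[)
      ((p i).[t] * (phi^`())%classic t) = inner `]x i, x i.+1[ w (phi^`())%classic.
    by apply: eq_Rintegral => t /(piecewise_itv min pw) ->.
  by rewrite (wgi _ tphi) => /oppr_inj <-; rewrite subrr.
apply: ae_imply (orthogonal_test_ae0 ig orth) => t g0 /g0 /eqP.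
by rewrite subr_eq0 => /eqP.
Qed.

(** Testing against a bump that does not vanish at the node, the weak derivative
    accounts for both integrals over the neighbouring elements, so what is left
    of the integration by parts is the jump at the node times the bump. *)
Lemma weak_derivative_matching m n p w g : increasing x m n ->
  piecewise x m n p w -> weak_derivative `]x m, x n[ w g -> matching x m n p.
Proof.
move=> inc pw wg i mi im.
have ii2 : (i <= i.+2)%N by rewrite leqW.
have inci : increasing x i i.+2 by exact: increasingS inc.
have pwi : piecewise x i i.+2 p w by exact: piecewiseS pw.
have mn : (m <= n)%N by rewrite (leq_trans mi) ?(leq_trans _ im) ?leqW.
have sub : `]x i, x i.+2[ `<=` `]x m, x n[.
  exact: node_itvS.
have [lg wgi] : weak_derivative `]x i, x i.+2[ w g.
  exact: weak_derivativeS wg.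
have [x01 x12] : x i < x i.+1 /\ x i.+1 < x i.+2.
  by split; apply: inci; rewrite ?leqnn ?leqnSn ?ltnS.
pose c := (x i + x i.+1) / 2; pose d := (x i.+1 + x i.+2) / 2.
have tphi : test_function `]x i, x i.+2[ (bump c d 1).
  apply: test_function_bump => // t /=; rewrite !in_itv/= => /andP[ct td].
  rewrite (lt_le_trans _ ct) ?(le_lt_trans td)// /c /d; lra.
have [cphi cdphi] := test_function_continuous tphi.
have := wgi _ tphi; rewrite (inner_piecewise_deriv ii2 inci pwi tphi).
rewrite /inner Rintegral_pieces//; last first.
  by apply: L2_mul_integrable => //; exact: continuous_L2.
rewrite [X in _ - X = _](_ : _ = \sum_(i <= j < i.+2)
   \int[mu]_(t in `]x j, x j.+1[) (g t * bump c d 1 t)); last first.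
  rewrite big_nat_cond [RHS]big_nat_cond; apply: eq_bigr => j /andP[ij _].
  have [lgj wgj] : weak_derivative `]x j, x j.+1[ w g.
    apply: weak_derivativeS wg => //; apply: node_itvS inc _ _ _ => //.
      by move: ij im mi; lia.
    by move: ij im mi; lia.
  apply: ae_eq_Rintegral.
  - apply: measurable_funM; apply: L2_measurable => //; last exact: continuous_L2.
    exact: horner_L2.
  - by apply: measurable_funM; apply: L2_measurable => //; exact: continuous_L2.
  - have := weak_derivative_poly ij inci pwi (conj lg wgi).
    by apply: ae_imply => t gp /gp ->.
move=> /eqP; rewrite subr_eq addNr.
rewrite big_nat_recr//= big_nat1.
have [-> ->] := test_function_ends tphi.
rewrite !mulr0 subr0 sub0r subr_eq0 => /eqP; apply: mulIf.
rewrite bump_neq0// /c /d; apply/andP; split; lra.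
Qed.

Lemma matching_grad m n p w : (m <= n)%N -> increasing x m n ->
  piecewise x m n p w -> matching x m n p ->
  weak_derivative `]x m, x n[ w (grad `]x m, x n[ w).
Proof.
move=> mn inc pw mp; have [g pg] := piecewise_exists (fun i => (p i)^`()) inc.
have wg : weak_derivative `]x m, x n[ w g by exact: matching_weak_derivative pg.
have := @xgetPex _ (cst 0) [set g | weak_derivative `]x m, x n[ w g].
by apply; exists g.
Qed.

End weak_derivative_piecewise.

(** * Moments and hat functions *)

Section moments.
Context {R : realType}.
Implicit Types (a b : R) (f : R -> R) (p q : {poly R}).

Definition moment a b f p : R := inner `]a, b[ f (horner p).

Lemma momentD a b f p q : L2 `]a, b[ f ->
  moment a b f (p + q) = moment a b f p + moment a b f q.
Proof.
move=> lf; rewrite /moment /inner -RintegralD//; last 2 first.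
- by apply: L2_mul_integrable => //; exact: horner_L2.
- by apply: L2_mul_integrable => //; exact: horner_L2.
by apply: eq_Rintegral => t _; rewrite hornerD mulrDr.
Qed.

Lemma moment0 a b f : moment a b f 0 = 0.
Proof.
rewrite /moment /inner; under eq_Rintegral do rewrite horner0 mulr0.
by rewrite Rintegral_cst// mul0r.
Qed.

Lemma moment_deriv a b p c : a < b ->
  moment a b (cst 1) (c *: p^`()) = c * (p.[b] - p.[a]).
Proof.
move=> ab; rewrite -(Rintegral_deriv_poly _ ab) -RintegralZl//; last first.
  exact/L2_integrable/horner_L2.
by apply: eq_Rintegral => t _; rewrite mul1r hornerZ.
Qed.

End moments.

Section hat_functions.
Context {R : realType}.
Implicit Types (x : nat -> R) (a i : nat).

(** The polynomial of the hat function of the node [a] on ]x_i, x_(i+1)[. *)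
Definition hat_poly x a i : {poly R} :=
  if i == a then (x i.+1 - x i)^-1 *: ((x i.+1)%:P - 'X)
  else if i.+1 == a then (x i.+1 - x i)^-1 *: ('X - (x i)%:P) else 0.

Lemma size_hat_poly x a i : (size (hat_poly x a i) <= 2)%N.
Proof.
rewrite /hat_poly; case: ifP => _; last case: ifP => _; last by rewrite size_poly0.
  by rewrite (leq_trans (size_scale_leq _ _))// -opprB size_polyN size_XsubC.
by rewrite (leq_trans (size_scale_leq _ _))// size_XsubC.
Qed.

Lemma size_hat_mul x a i k (q : {poly R}) :
  (size q <= k.+1)%N -> (size (hat_poly x a i * q)%R <= k.+2)%N.
Proof.
move=> sq; have := size_polyMleq (hat_poly x a i) q.
by have := size_hat_poly x a i; lia.
Qed.

(** The two hat functions that live on an element form a partition of unity: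
    this is what turns the local problems into the global orthogonality. *)
Lemma hat_poly_sum x i : x i < x i.+1 -> hat_poly x i i + hat_poly x i.+1 i = 1.
Proof.
move=> xi; rewrite /hat_poly eqxx ltn_eqF// eqxx -scalerDr.
rewrite [X in _ *: X](_ : _ = (x i.+1 - x i)%:P); last by rewrite polyCB; ring.
by rewrite -mul_polyC -polyCM mulVf// subr_eq0 gt_eqF.
Qed.

Lemma hat_poly_left x i : x i < x i.+1 ->
  (hat_poly x i i).[x i] = 1 /\ (hat_poly x i i).[x i.+1] = 0.
Proof.
move=> xi; rewrite /hat_poly eqxx !hornerZ !hornerD !hornerN !hornerC !hornerX.
by rewrite subrr mulr0 mulVf// subr_eq0 gt_eqF.
Qed.

Lemma hat_poly_right x i : x i < x i.+1 ->
  (hat_poly x i.+1 i).[x i.+1] = 1 /\ (hat_poly x i.+1 i).[x i] = 0.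
Proof.
move=> xi; rewrite /hat_poly ltn_eqF// eqxx.
rewrite !hornerZ !hornerD !hornerN !hornerC !hornerX.
by rewrite subrr mulr0 mulVf// subr_eq0 gt_eqF.
Qed.

End hat_functions.

(** * The local problem on a patch *)

Section patches.
Context {R : realType} {alpha beta : R} (T : mesh alpha beta).
Notation mu := (@lebesgue_measure R).
Notation x := (node T).
Notation N := (nb_elt T).
Implicit Types (a : vertex T) (i k : nat) (f uh w : R -> R) (b : R).

(** The patch of [a] consists of the elements ]x_i, x_(i+1)[ with
    lo a <= i < hi a, so that it is an instance of a chain of consecutive nodes. *)
Definition lo a : nat := (a : nat).-1.
Definition hi a : nat := minn (a : nat).+1 N.

Lemma mesh_increasing m n : (n <= N)%N -> increasing x m n.
Proof. by move=> nN i /andP[_ im]; apply: node_lt; exact: leq_trans im nN. Qed.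

Lemma lo_hi a : (lo a <= hi a)%N.
Proof. by have := ltn_ord a; rewrite /lo /hi /vertex; lia. Qed.

Lemma hi_N a : (hi a <= N)%N. Proof. exact: geq_minr. Qed.

Lemma patchP a i : (lo a <= i < hi a)%N =
  (i < N)%N && ((i == a :> nat) || (i.+1 == a :> nat)).
Proof. by have := ltn_ord a; rewrite /lo /hi; lia. Qed.

Lemma hat_piecewise a : piecewise x 0 N (hat_poly x a) (hat a).
Proof.
move=> i t /andP[_ iN] /andP[it ti].
have inc := @mesh_increasing 0 N (leqnn N).
have aN : (a <= N)%N by have := ltn_ord a; rewrite ltnS.
rewrite /hat /hat_poly; have [ia|ia|ia] := ltngtP i a.
- have tA : t < x a by apply: (lt_le_trans ti); apply: (node_le inc).
  rewrite leNgt tA andbF /=; have [ia1|ia1] := eqVneq i.+1 a.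
    have aE : a.-1 = i by rewrite -ia1.
    rewrite aE -{2}ia1 -{1}ia1 (ltW it) ia1 (ltW tA) (leq_ltn_trans _ ia)//=.
    by rewrite hornerZ hornerD hornerN hornerC hornerX mulrC.
  have ia2 : (i.+1 <= a.-1)%N by move: ia ia1; lia.
  rewrite horner0 ifF//; apply/negbTE; rewrite !negb_and -!ltNge.
  rewrite (lt_le_trans ti) ?orbT//.
  by apply: (node_le inc) => //; move: ia2 aN; lia.
- have aS : x a.+1 <= x i by apply: (node_le inc) => //; exact: ltnW.
  have aS' : x a <= x i by apply: (node_le inc) => //; exact: ltnW.
  rewrite (gtn_eqF (leqW ia)) horner0 ifF; last first.
    by rewrite [t <= _]leNgt (le_lt_trans aS it) !andbF.
  by rewrite ifF// [t <= _]leNgt (le_lt_trans aS' it) !andbF.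
- rewrite -ia iN (ltW it) (ltW ti) /= hornerZ hornerD hornerN hornerC hornerX.
  by rewrite mulrC.
Qed.

Lemma broken_polyE k a w : broken_poly k (elts_at a) w ->
  exists2 q : nat -> {poly R}, piecewise x (lo a) (hi a) q w &
    forall i, (lo a <= i < hi a)%N -> (size (q i) <= k.+1)%N.
Proof.
move=> bp.
have /choice[q qP] i : exists p : {poly R}, (lo a <= i < hi a)%N ->
    (size p <= k.+1)%N /\ forall t, x i < t < x i.+1 -> w t = p.[t].
  have [ia|/negP nia] := boolP (lo a <= i < hi a)%N; last by exists 0.
  move: (ia); rewrite patchP => /andP[iN ia'].
  have [|p sp wp] := bp (Ordinal iN); first exact: ia'.
  by exists p => _; split=> // t ti; apply: wp; rewrite /elt/= in_itv.
exists q => [i t ia ti|i ia]; last by have [] := qP _ ia.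
by have [_] := qP _ ia; apply.
Qed.

Lemma hat_piecewise_patch a : piecewise x (lo a) (hi a) (hat_poly x a) (hat a).
Proof. by apply: piecewiseS (@hat_piecewise a) => //; exact: hi_N. Qed.

Lemma patch_inner_node a i : (lo a <= i)%N -> (i.+1 < hi a)%N -> i.+1 = a.
Proof. by rewrite /lo /hi; lia. Qed.

Lemma hat_matching a : matching x (lo a) (hi a) (hat_poly x a).
Proof.
move=> i li ih; have ia := patch_inner_node li ih.
have ihN : (i.+1 < N)%N by exact: leq_trans ih (hi_N a).
rewrite -ia; rewrite (hat_poly_right (node_lt (ltnW ihN))).1.
by rewrite (hat_poly_left (node_lt ihN)).1.
Qed.

Lemma grad_hat a i : (lo a <= i < hi a)%N ->
  {ae mu, forall t, t \in `]x i, x i.+1[ ->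
     grad (omega a) (hat a) t = (hat_poly x a i)^`().[t]}.
Proof.
move=> ia; have inc := @mesh_increasing (lo a) (hi a) (hi_N a).
have ph := @hat_piecewise_patch a.
have wg := matching_grad (lo_hi a) inc ph (@hat_matching a).
exact: weak_derivative_poly ia inc ph wg.
Qed.

Lemma grad_L2 a w p i : (lo a <= i < hi a)%N -> piecewise x (lo a) (hi a) p w ->
  matching x (lo a) (hi a) p -> L2 `]x i, x i.+1[ (grad (omega a) w).
Proof.
move=> /andP[li ih] pw mp.
have inc := @mesh_increasing (lo a) (hi a) (hi_N a).
have [lg _] := matching_grad (lo_hi a) inc pw mp.
by apply: L2S lg => //; exact: (node_itvS inc).
Qed.

Lemma hat_mul_piecewise a q w : piecewise x (lo a) (hi a) q w ->
  piecewise x (lo a) (hi a) (fun i => hat_poly x a i * q i) (hat a \* w).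
Proof.
move=> pw i t ia ti.
by rewrite /= (hat_piecewise_patch ia ti) (pw _ _ ia ti) hornerM.
Qed.

Lemma hat_mul_matching a q : matching x (lo a) (hi a) q ->
  matching x (lo a) (hi a) (fun i => hat_poly x a i * q i).
Proof. by move=> mq i li ih; rewrite !hornerM mq// hat_matching. Qed.

Lemma L2_elt g i : L2 `]alpha, beta[ g -> (i < N)%N -> L2 `]x i, x i.+1[ g.
Proof.
move=> lg iN; apply: L2S lg => //.
have <- : `]x 0, x N[ = `]alpha, beta[ by rewrite node_first node_last.
exact: (node_itvS (@mesh_increasing 0 N (leqnn N))).
Qed.

Lemma patch_lt a i : (lo a <= i < hi a)%N -> (i < N)%N.
Proof. by move=> /andP[_ ih]; exact: leq_trans ih (hi_N a). Qed.

(** On each element the local problem becomes an identity between moments of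
    polynomials, in which every weak gradient has been evaluated. *)
Lemma local_element_eq b f uh k a w q i (v : {poly R}) :
  L2 `]alpha, beta[ f -> L2 `]alpha, beta[ uh -> local_solution b f uh k a w ->
  piecewise x (lo a) (hi a) q w -> matching x (lo a) (hi a) q ->
  (lo a <= i < hi a)%N -> (size v <= k.+1)%N ->
  moment (x i) (x i.+1) (cst 1) (b *: (hat_poly x a i * q i)^`() * v) =
  moment (x i) (x i.+1) f (hat_poly x a i * v) +
  moment (x i) (x i.+1) uh (b *: (hat_poly x a i)^`() * v).
Proof.
move=> lf lu [_ _ orth] pw mq ia sv; have iN := patch_lt ia.
(* Broken polynomials need not be continuous, so [v] can be localized. *)
pose vh t := if x i < t < x i.+1 then v.[t] else 0.
have inc := @mesh_increasing (lo a) (hi a) (hi_N a).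
have bvh : broken_poly k (elts_at a) vh.
  move=> j _; have [ji|ji] := eqVneq (j : nat) i.
    exists v => // t; rewrite /elt ji /= in_itv /vh /= => ->//.
  exists 0; first by rewrite size_poly0.
  move=> t; rewrite /elt /= in_itv/= => tj; rewrite /vh horner0; case: ifPn => // ti.
  move: ji; rewrite (@element_inj _ x 0 N j i t _ _ _ tj ti) ?eqxx//.
  - exact: mesh_increasing.
  - exact: ltn_ord.
have sub : `]x i, x i.+1[ `<=` omega a.
  by move/andP: ia => [li ih]; exact: (node_itvS inc).
have innerE F : inner (omega a) F vh = \int[mu]_(t in `]x i, x i.+1[) (F t * v.[t]).
  rewrite /inner (Rintegral_support sub).
    apply: eq_Rintegral => t; rewrite inE/= in_itv/= /vh => ->//.
  move=> t _ /=; rewrite in_itv/= /vh => /negP/negbTE->; exact: mulr0.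
have lv (p : {poly R}) : L2 `]x i, x i.+1[ (horner p) by exact: horner_L2.
have mv p := L2_measurable (measurable_itv _) (lv p).
have phw := hat_mul_piecewise pw; have mhw := hat_mul_matching mq.
have gw := weak_derivative_poly ia inc phw
  (matching_grad (lo_hi a) inc phw mhw).
have lgw := grad_L2 ia phw mhw.
have gh := grad_hat ia.
have lgh := grad_L2 ia (@hat_piecewise_patch a) (@hat_matching a).
have mf := L2_measurable (measurable_itv _) (L2_elt lf iN).
have mu_ := L2_measurable (measurable_itv _) (L2_elt lu iN).
have mgw := L2_measurable (measurable_itv _) lgw.
have mgh := L2_measurable (measurable_itv _) lgh.
have mhat : measurable_fun `]x i, x i.+1[ (hat a).
  apply: (eq_measurable_fun (horner (hat_poly x a i))) (mv _) => t.
  by rewrite inE/= in_itv/= => ti; rewrite (hat_piecewise_patch ia ti).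
have := orth vh bvh; rewrite !innerE => orth_i.
transitivity (\int[mu]_(t in `]x i, x i.+1[)
    ((b \*o grad (omega a) (hat a \* w)) t * v.[t])).
  apply: ae_eq_Rintegral.
  - by apply: measurable_funM => //; exact: mv.
  - by apply: measurable_funM; [apply: measurable_funM|exact: mv].
  - by apply: ae_imply gw => t gwt /gwt /= ->; rewrite mul1r hornerM hornerZ.
rewrite orth_i /moment /inner -RintegralD//; last 2 first.
- by apply: L2_mul_integrable => //; exact: L2_elt.
- by apply: L2_mul_integrable => //; exact: L2_elt.
apply: ae_eq_Rintegral.
- apply: measurable_funM; last exact: mv.
  apply: measurable_funD; first exact: measurable_funM.
  by apply: measurable_funM => //; exact: measurable_funM.
- apply: measurable_funD; apply: measurable_funM => //; exact: mv.
- apply: ae_imply gh => t ght ti; move/ght: (ti) => /= ->.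
  rewrite (hat_piecewise_patch ia); last by move: ti; rewrite in_itv.
  by rewrite !hornerM hornerZ; ring.
Qed.

(** For a boundary vertex the patch is a single element, and the hypothesis on
    [uh] at an inflow vertex becomes a statement about moments on it. *)
Lemma boundary_moments b f uh a i :
  L2 `]alpha, beta[ uh -> lo a = i -> hi a = i.+1 ->
  inner (omega a) f (hat a) +
  inner (omega a) uh (b \*o grad (omega a) (hat a)) =
  moment (x i) (x i.+1) f (hat_poly x a i) +
  moment (x i) (x i.+1) uh (b *: (hat_poly x a i)^`()).
Proof.
move=> lu li hi1; have ia : (lo a <= i < hi a)%N by rewrite li hi1 leqnn /=.
have iN := patch_lt ia.
have omE : omega a = `]x i, x i.+1[%classic by rewrite -{1}li -hi1.
have gh := grad_hat ia.
have lgh := grad_L2 ia (@hat_piecewise_patch a) (@hat_matching a).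
rewrite omE in gh lgh *; congr (_ + _).
  apply: eq_Rintegral => t; rewrite inE/= in_itv/= => ti.
  by rewrite (hat_piecewise_patch ia ti).
apply: ae_eq_Rintegral.
- apply: measurable_funM; first exact: L2_measurable (L2_elt lu iN).
  by apply: measurable_funM => //; exact: L2_measurable lgh.
- apply: measurable_funM; first exact: L2_measurable (L2_elt lu iN).
  exact: L2_measurable (horner_L2 _ _ _).
- by apply: ae_imply gh => t ght /ght /= ->; rewrite hornerZ.
Qed.

End patches.

(** * The reconstruction *)

Theorem lemma5p3 (R : realType) (alpha beta : R) (hOmega : alpha < beta)
  (b : R) (hb : b != 0)
  (f : R -> R) (hf : L2 `]alpha, beta[ f)
  (Th : mesh alpha beta) (k' : nat)
  (uh : R -> R) (huh : L2 `]alpha, beta[ uh)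
  (huh_orth : forall a : vertex Th, interior_vertex a \/ inflow_vertex b a ->
     inner (omega a) f (hat a)
       + inner (omega a) uh (b \*o grad (omega a) (hat a)) = 0)
  (s : vertex Th -> R -> R)
  (hs : forall a : vertex Th, local_solution b f uh k' a (s a)) :
  [/\ broken_poly (T := Th) k'.+1 predT (reconstruction s),
      H1_inflow alpha beta b (reconstruction s) &
      forall (K : element Th) (vh : {poly R}), (size vh <= k'.+1)%N ->
        inner (elt K) (f \- (b \*o grad `]alpha, beta[ (reconstruction s)))
          (fun x => vh.[x]) = 0].
Proof.
pose x := node Th; pose N := nb_elt Th.
have inc : increasing x 0 N by exact: mesh_increasing.
have x0 : x 0%N = alpha by exact: node_first.
have xN : x N = beta by exact: node_last.
have N0 : (0 < N)%N.
  rewrite lt0n; apply/eqP => N0; move: hOmega.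
  by rewrite -x0 -xN N0 ltxx.
have DE : `]alpha, beta[%classic = `]x 0, x N[%classic by rewrite x0 xN.
(* [Q a i] is the polynomial of [s a] on the element [i] of the patch. *)
have /choice[Q QP] (a : vertex Th) : exists q : nat -> {poly R},
    [/\ piecewise x (lo a) (hi a) q (s a), matching x (lo a) (hi a) q &
      forall i, (lo a <= i < hi a)%N -> (size (q i) <= k'.+1)%N].
  have [bp [_ [g wg]] _] := hs a; have [q pq sq] := broken_polyE bp.
  exists q; split=> //; apply: weak_derivative_matching pq wg.
  by apply: mesh_increasing; exact: hi_N.
pose V i : vertex Th := inord i.
have VE i : (i <= N)%N -> V i = i :> nat by move=> iN; rewrite /V inordK.
have Vl i : (i < N)%N -> (lo (V i) <= i < hi (V i))%N.
  by move=> iN; rewrite patchP iN VE ?eqxx//; exact: ltnW.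
have Vr i : (i < N)%N -> (lo (V i.+1) <= i < hi (V i.+1))%N.
  by move=> iN; rewrite patchP iN VE// eqxx orbT.
(* The polynomial of the reconstruction on the element [i]. *)
pose P i := hat_poly x i i * Q (V i) i + hat_poly x i.+1 i * Q (V i.+1) i.
have recP : piecewise x 0 N P (reconstruction s).
  move=> i t /andP[_ iN] ti; rewrite /reconstruction.
  have termE (a : vertex Th) : (lo a <= i < hi a)%N ->
      ((hat a \* s a) \_ (omega a)) t = (hat_poly x a i * Q a i).[t].
    move=> ia; have [pq _ _] := QP a.
    rewrite patchE mem_set ?(hat_mul_piecewise pq ia ti)//.
    have := @node_itvS _ x _ _ i i.+1
      (@mesh_increasing _ _ _ Th (lo a) (hi a) (hi_N a)).
    by case/andP: ia => li ih; move/(_ li (leqnSn i) ih); apply; rewrite /= in_itv.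
  have Vneq : V i.+1 != V i.
    by rewrite -val_eqE /= !VE ?gtn_eqF//; exact: ltnW.
  rewrite (bigD1 (V i))//= (bigD1 (V i.+1))//= big1 ?addr0; last first.
    move=> a /andP[ai ai1]; rewrite patchE; case: ifPn => //= _.
    rewrite (hat_piecewise a iN ti) /hat_poly.
    rewrite !ifF ?horner0 ?mul0r//; apply/negbTE.
      apply: contra ai1 => /eqP ia; apply/eqP/val_inj; rewrite /= VE//.
    by apply: contra ai => /eqP ia; apply/eqP/val_inj; rewrite /= VE// ltnW.
  by rewrite termE ?Vl// termE ?Vr// hornerD !VE// ltnW.
have matchP : matching x 0 N P.
  move=> i _ iN; have iN' := ltnW iN.
  have xi : x i < x i.+1 by exact: node_lt.
  have xi1 : x i.+1 < x i.+2 by exact: node_lt.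
  rewrite !hornerD !hornerM (hat_poly_left xi).2 (hat_poly_right xi).1.
  rewrite (hat_poly_left xi1).1 (hat_poly_right xi1).2 !mul0r !mul1r add0r addr0.
  have [_ mq _] := QP (V i.+1); apply: mq.
    by rewrite /lo VE.
  by rewrite /hi VE// leq_min ltnSn.
have wdP := matching_grad (leq0n N) inc recP matchP.
have [wc cwc wcE] := continuous_version (leq0n N) inc matchP.
have momE (K : element Th) (v : {poly R}) : (size v <= k'.+1)%N ->
    moment (x K) (x K.+1) (cst 1) (b *: (P K)^`() * v) =
    moment (x K) (x K.+1) f v.
  move=> sv; have KN : (K < N)%N by exact: ltn_ord.
  have [pl ml _] := QP (V K); have [pr mr _] := QP (V K.+1).
  have := local_element_eq hf huh (hs (V K)) pl ml (Vl K KN) sv.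
  have := local_element_eq hf huh (hs (V K.+1)) pr mr (Vr K KN) sv.
  rewrite !VE//; last exact: ltnW.
  move=> er el; have lf := L2_elt hf KN; have lu := L2_elt huh KN.
  rewrite /P derivD scalerDr mulrDl momentD ?el ?er; last first.
    by apply: continuous_L2; exact: cst_continuous.
  (* The hat polynomials sum to 1 and their derivatives to 0. *)
  rewrite addrACA -!momentD// -!mulrDl -scalerDr -derivD hat_poly_sum ?node_lt//.
  by rewrite -[1]/(1%:P) derivC scaler0 mul0r moment0 addr0 mul1r.
split.
- move=> K _; exists (P K); last first.
    by move=> t; rewrite /elt/= in_itv/= => /recP->//; exact: ltn_ord.
  have KN : (K < N)%N by exact: ltn_ord.
  have [_ _ sl] := QP (V K); have [_ _ sr] := QP (V K.+1).
  rewrite (leq_trans (size_polyD _ _))// geq_max.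
  by rewrite !size_hat_mul ?sl ?sr ?Vl ?Vr.
- have lrec : L2 `]alpha, beta[ (reconstruction s).
    by rewrite DE; exact: piecewise_L2 (leq0n N) inc recP.
  split; first by split=> //; rewrite DE; eexists; exact: wdP.
  exists wc; split; first exact: continuous_subspaceT.
    have <- : `]x 0%N, x N[ = `]alpha, beta[ by rewrite x0 xN.
    apply: ae_pieces => // i iN; apply: aeW => t.
    rewrite in_itv/= => ti; rewrite (recP _ _ iN ti) (wcE _ _ iN)//.
    by case/andP: ti => /ltW-> /ltW->.
  move=> t [tab]; rewrite /outward_normal; case: tab => ->.
    rewrite eqxx mulrN1 oppr_lt0 => b0.
    (* Here b > 0 and the inflow vertex is the first one; testing its local
       problem with v = 1, the right-hand side is zero, and the left-hand side
       is -b times the boundary value. *)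
    have x01 : x 0%N < x 1%N by exact: node_lt.
    rewrite -x0 (wcE 0%N) ?lexx ?ltW// /P hornerD !hornerM.
    rewrite (hat_poly_left x01).1 (hat_poly_right x01).2 mul0r addr0 mul1r.
    have [pq mq _] := QP (V 0%N).
    have := local_element_eq hf huh (hs (V 0%N)) pq mq (Vl 0%N N0) (v := 1).
    rewrite size_poly1 => /(_ isT); rewrite !mulr1 VE//.
    have lo0 : lo (V 0%N) = 0%N by rewrite /lo VE.
    have hi0 : hi (V 0%N) = 1%N by rewrite /hi VE//; apply/minn_idPl.
    have := boundary_moments b f huh lo0 hi0.
    rewrite huh_orth; last first.
      right; split; first by left; rewrite VE.
      by rewrite /outward_normal VE// -/x x0 eqxx mulrN1 oppr_lt0.
    rewrite VE// => <-; rewrite moment_deriv// !hornerM.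
    rewrite (hat_poly_left x01).1 (hat_poly_left x01).2 mul0r mul1r sub0r.
    by move/eqP; rewrite mulf_eq0 (negbTE hb) oppr_eq0 => /eqP.
  rewrite gt_eqF// mulr1 => b0.
  (* The mirror case b < 0, where the inflow vertex is the last one. *)
  have NE : N = N.-1.+1 by rewrite prednK.
  have N1N : (N.-1 < N)%N by rewrite {2}NE.
  have x01 : x N.-1 < x N.-1.+1 by exact: node_lt.
  rewrite -xN (wcE N.-1) ?N1N//; last by rewrite {2 3}NE lexx ltW.
  have -> : x N = x N.-1.+1 by rewrite -NE.
  rewrite /P hornerD !hornerM.
  rewrite (hat_poly_left x01).2 (hat_poly_right x01).1 mul0r add0r mul1r.
  have [pq mq _] := QP (V N.-1.+1).
  have := local_element_eq hf huh (hs (V N.-1.+1)) pq mq (Vr N.-1 N1N)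
    (v := 1).
  rewrite size_poly1 => /(_ isT); rewrite !mulr1 VE//.
  have loN : lo (V N.-1.+1) = N.-1 by rewrite /lo VE.
  have hiN : hi (V N.-1.+1) = N.-1.+1 by rewrite /hi VE// -/N -NE; apply/minn_idPr.
  have := boundary_moments b f huh loN hiN.
  rewrite huh_orth; last first.
    right; split; first by right; rewrite VE// -NE.
    by rewrite /outward_normal VE// -NE -/x xN gt_eqF// mulr1.
  rewrite VE// => <-; rewrite moment_deriv// !hornerM.
  rewrite (hat_poly_right x01).1 (hat_poly_right x01).2 mul0r mul1r subr0.
  by move/eqP; rewrite mulf_eq0 (negbTE hb) => /eqP.
- move=> K v sv; have KN : (K < N)%N by exact: ltn_ord.
  have gP := weak_derivative_poly (i := K) (m := 0%N) (n := N) KN inc recP wdP.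
  have lv (p : {poly R}) : L2 `]x K, x K.+1[ (horner p) by exact: horner_L2.
  have lK : L2 `]x K, x K.+1[ f by exact: L2_elt.
  have lg : L2 `]x K, x K.+1[ (grad `]alpha, beta[ (reconstruction s)).
    by apply: L2_elt => //; rewrite [X in L2 X]DE [X in grad X]DE; case: wdP.
  rewrite /inner /elt -/x.
  have -> : 0 = moment (x K) (x K.+1) f v -
      moment (x K) (x K.+1) (cst 1) (b *: (P K)^`() * v).
    by rewrite momE// subrr.
  rewrite /moment /inner -RintegralB//; last 2 first.
  + exact: L2_mul_integrable.
  + by apply: L2_mul_integrable => //; apply: continuous_L2; exact: cst_continuous.
  have mK := L2_measurable (measurable_itv _) lK.
  have mg := L2_measurable (measurable_itv _) lg.
  have mv p := L2_measurable (measurable_itv _) (lv p).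
  apply: ae_eq_Rintegral.
  + apply: measurable_funM; last exact: mv.
    by apply: measurable_funB => //; exact: measurable_funM.
  + by apply: measurable_funB; apply: measurable_funM => //; exact: mv.
  + apply: ae_imply gP => t gPt /gPt; rewrite -DE /= => ->.
    by rewrite mul1r hornerM hornerZ mulrBl.
Qed.
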